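(* All jumping numbers of $\mathfrak a$ are supercandidates, i.e. every jumping number of $\mathfrak a$ belongs to the set $S$.
   Context: Let $k$ be an algebraically closed field of characteristic zero and $R$ a regular local ring over $k$ of dimension at least $2$ such that $X=\operatorname{Spec} R$ is the germ of a smooth algebraic variety over $k$. Let $\mathfrak a$ be a (nonzero, proper) ideal sheaf on $X$ and let $\pi:Y\to X$ be a fixed log resolution of $(X,\mathfrak a)$: a proper birational morphism with $Y$ smooth, $\mathfrak a\cdot\mathcal O_Y=\mathcal O_Y(-F)$ for an effective Cartier divisor $F$, and $F+\mathrm{Exc}(\pi)$ a simple normal crossing divisor. Write $F=\sum_{i\in I}e_iE_i$ with $E_i$ ($i\in I$) the irreducible components of $F$ and $e_i\in\mathbb Z_{>0}$. Let $K_\pi=K_Y-\pi^*K_X$ be the relative canonical divisor, chosen as the unique effective representative supported on $\mathrm{Exc}(\pi)$; $k_i$ denotes the coefficient of $E_i$ in $K_\pi$ (so $k_i=0$ if $E_i$ is not exceptional). Round-downs $\lfloor\cdot\rfloor$ of $\mathbb Q$-divisors are taken coefficientwise. Multiplier ideals: $\mathcal J(\mathfrak a^c)=\pi_*\mathcal O_Y(K_\pi-\lfloor cF\rfloor)\subseteq\mathcal O_X$ for $c\in\mathbb Q_{\geq0}$. There is an increasing sequence of rational numbers $0=\lambda_0<\lambda_1<\lambda_2<\dots$ with $\mathcal J(\mathfrak a^c)=\mathcal J(\mathfrak a^{\lambda_i})$ for $c\in[\lambda_i,\lambda_{i+1})$ and $\mathcal J(\mathfrak a^{\lambda_i})\supsetneq\mathcal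 J(\mathfrak a^{\lambda_{i+1}})$; the $\lambda_i$ with $i>0$ are the jumping numbers of $\mathfrak a$. A divisor $D$ (integer coefficients) on $Y$ is $\pi$-antieffective if $H^0(E,\mathcal O_Y(-D)|_E)\neq0$ for every $\pi$-exceptional prime divisor $E$. The $\pi$-antieffective closure of a divisor $D$ is the unique $\pi$-antieffective divisor $\tilde D\geqslant D$ such that $D'\geqslant\tilde D$ for every $\pi$-antieffective $D'\geqslant D$ (it always exists). Supercandidates: the set $S\subset\mathbb Q$ is constructed inductively. Its first element is $\min\{\frac{k_i+1}{e_i}\mid i\in I\}$. If $\lambda$ is the element last added, the next element added is $\min\{\frac{k_i+1+e_i^{\lambda}}{e_i}\mid i\in I\}$, where $e_i^\lambda$ is the coefficient of $E_i$ in the $\pi$-antieffective closure $D_\lambda$ of $\lfloor\lambda F\rfloor-K_\pi$. The elements of $S$ are called supercandidates. *)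

(* Defs.v *)
From HB Require Import structures.
From mathcomp Require Import all_boot all_order all_algebra.
From mathcomp Require Import mathcomp_extra boolp classical_sets functions.
From mathcomp Require Import cardinality.

Set Implicit Arguments.
Unset Strict Implicit.
Unset Printing Implicit Defensive.

Import Order.TTheory GRing.Theory Num.Theory.
Local Open Scope classical_set_scope.
Local Open Scope ring_scope.

(* Integral separated schemes with function field K are represented, following
   Zariski (and EGA I, 8.2), by the set of their local rings inside K.  A point
   P is its own local ring O_P; P lies in the closure of Q iff P `<=` Q.  If P
   is a point of Y and pi : Y -> X is the birational morphism between two such
   models, pi(P) is the unique point of X that P dominates. *)

Section CommutativeAlgebra.
Variable K : fieldType.
Implicit Types (A B G I M P V p : set K) (x y : K).

Definition subring A : Prop := GRing.subring_closed [in A].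

Definition submodule A M : Prop :=
  [/\ M 0, forall x y, M x -> M y -> M (x + y)
    & forall a x, A a -> M x -> M (a * x)].

Definition span A G : set K := smallest (submodule A) G.

Definition ideal A I : Prop := submodule A I /\ I `<=` A.

Definition prime_ideal A p : Prop :=
  [/\ ideal A p, ~ p 1
    & forall x y, A x -> A y -> p (x * y) -> p x \/ p y].

Definition noetherian A : Prop :=
  forall I, ideal A I -> exists s : seq K, I = span A [set` s].

Definition prime_chain A (n : nat) (c : nat -> set K) : Prop :=
  (forall i, (i <= n)%N -> prime_ideal A (c i)) /\
  (forall i, (i < n)%N -> c i `<` c i.+1).

Definition krull_dim A (n : nat) : Prop :=
  (exists c, prime_chain A n c) /\ (forall c, ~ prime_chain A n.+1 c).

Definition is_unit A x : Prop := [/\ A x, x != 0 & A x^-1].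

Definition nonunits A : set K := [set x | A x /\ ~ is_unit A x].

Definition local_ring P : Prop := subring P /\ ideal P (nonunits P).

Definition regular_parameters P (t : seq K) : Prop :=
  krull_dim P (size t) /\ nonunits P = span P [set` t].

Definition regular_local_ring P : Prop :=
  [/\ local_ring P, noetherian P & exists t, regular_parameters P t].

Definition adjoin B (s : seq K) : set K := smallest subring (B `|` [set` s]).

Definition localization A p : set K :=
  [set x | exists a s, [/\ A a, A s, ~ p s & x = a / s]].

Definition Spec A : set (set K) :=
  [set P | exists2 p, prime_ideal A p & P = localization A p].

Definition valuation_ring V : Prop :=
  subring V /\ forall x, V x \/ V x^-1.

Definition dominates V P : Prop :=
  P `<=` V /\ nonunits P `<=` nonunits V.

(* The order of f along a discrete valuation ring E; ord E 0 = 0 by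
   convention. *)
Definition ord (E : set K) (f : K) : int :=
  xget 0 [set m : int | exists t u,
    [/\ nonunits E = span E [set t], is_unit E u & f = u * t ^ m]].

End CommutativeAlgebra.

Section Models.
Variable K : fieldType.
Implicit Types (R P Q E : set K) (X Y : set (set K)) (f g h : K).

(* R is the local ring of a point of a smooth (affine) k-variety with function
   field K; k is perfect, so smoothness is regularity of all local rings. *)
Definition smooth_germ (k : fieldType) (iota : {rmorphism k -> K}) R : Prop :=
  exists (s : seq K), let A := adjoin (range iota) s in
    [/\ forall P, Spec A P -> regular_local_ring P,
        Spec A R
      & forall x, exists a b, [/\ R a, R b & x = a / b]].

(* Y is of finite type over Spec R, and separated and proper by the valuative
   criterion. *)
Definition proper_birational_model R Y : Prop :=
  (exists cover : seq (seq K),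
     Y = \bigcup_(s in [set` cover]) Spec (adjoin R s)) /\
  (forall V, valuation_ring V -> R `<=` V ->
     exists! P, Y P /\ dominates V P).

(* Prime divisors are identified with their generic points. *)
Definition prime_divisor Y E : Prop := Y E /\ krull_dim E 1.

Definition exceptional R Y E : Prop := prime_divisor Y E /\ ~ Spec R E.

Definition divisor Y (D : set K -> int) : Prop :=
  (forall E, D E != 0 -> prime_divisor Y E) /\ finite_set [set E | D E != 0].

Definition le_divisor (D D' : set K -> int) : Prop := forall E, D E <= D' E.

Definition effective (D : set K -> int) : Prop := le_divisor (fun=> 0) D.

(* The stalk at P of O_Y(D), as a submodule of K. *)
Definition O_stalk Y (D : set K -> int) P : set K :=
  [set f | f = 0 \/
     forall E, prime_divisor Y E -> P `<=` E -> 0 <= ord E f + D E].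

Definition global_sections Y (D : set K -> int) : set K :=
  [set f | forall P, Y P -> O_stalk Y D P f].

Definition lin_equiv Y (D D' : set K -> int) : Prop :=
  exists2 g, g != 0 & forall E, prime_divisor Y E -> D E = D' E + ord E g.

(* D' is the pullback to Y of the divisor D on X: a local equation of D at
   pi(P) is a local equation of D' at P. *)
Definition pullback X Y (D D' : set K -> int) : Prop :=
  divisor Y D' /\
  forall P Q, Y P -> X Q -> dominates P Q -> exists2 h, h != 0 &
    (forall E, prime_divisor X E -> Q `<=` E -> D E = ord E h) /\
    (forall E, prime_divisor Y E -> P `<=` E -> D' E = ord E h).

Definition ideal_at E P : set K := nonunits E `&` P.

Definition snc_divisor Y (D : set K -> int) : Prop :=
  divisor Y D /\
  forall P, Y P -> exists2 t, regular_parameters P t &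
    forall E, D E != 0 -> P `<=` E ->
      exists2 z, z \in t & ideal_at E P = span P [set z].

Definition Exc R Y (E : set K) : int :=
  if `[< exceptional R Y E >] then 1 else 0.

End Models.

Section RelativeCanonicalDivisor.
Variables (k K : fieldType) (iota : {rmorphism k -> K}).

Definition derivation (d : K -> K) : Prop :=
  [/\ forall x y, d (x + y) = d x + d y,
      forall x y, d (x * y) = x * d y + y * d x
    & forall c, d (iota c) = 0].

Definition derivation_basis (n : nat) (d : 'I_n -> K -> K) : Prop :=
  (forall i, derivation (d i)) /\
  (forall e, derivation e ->
     exists! c : 'rV[K]_n, forall x, e x = \sum_i c ord0 i * d i x).

(* A basis d of Der_k(K) identifies the space of rational top forms with K, by
   evaluation at d: dx_1 /\ ... /\ dx_n corresponds to det (d_i x_j).  Under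
   this identification omega_stalk d P is the stalk at P of the canonical
   sheaf, which is generated by the dx_1 /\ ... /\ dx_n with x_j in O_P. *)
Definition omega_stalk (n : nat) (d : 'I_n -> K -> K) (P : set K) : set K :=
  span P [set \det (\matrix_(i < n, j < n) d i (x j))
         | x in [set x : 'I_n -> K | forall j, P (x j)]].

(* D is the divisor of the rational top form dual to d. *)
Definition canonical_divisor (Y : set (set K)) (n : nat) (d : 'I_n -> K -> K)
    (D : set K -> int) : Prop :=
  divisor Y D /\ forall P, Y P -> omega_stalk d P = O_stalk Y D P.

Definition relative_canonical_divisor (R : set K) (Y : set (set K))
    (Kpi : set K -> int) : Prop :=
  [/\ divisor Y Kpi, effective Kpi,
      forall E, Kpi E != 0 -> exceptional R Y E
    & exists n (d : 'I_n -> K -> K) KY KX piKX,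
      [/\ derivation_basis d, canonical_divisor Y d KY,
          canonical_divisor (Spec R) d KX, pullback (Spec R) Y KX piKX
        & lin_equiv Y Kpi (KY \- piKX)]].

End RelativeCanonicalDivisor.

Section Antieffective.
Variables (K : fieldType) (R : set K) (Y : set (set K)).
Implicit Types (D F Kpi : set K -> int) (E P Q : set K).

(* I_E * O_Y(-D) at P, the kernel of O_Y(-D) -> O_Y(-D)|_E. *)
Definition restriction_kernel D E P : set K :=
  span P [set x * y | x in ideal_at E P & y in O_stalk Y (\- D) P].

(* A global section of O_Y(-D)|_E = O_Y(-D) / (I_E * O_Y(-D)): s P represents
   its germ at the point P of E.  The points of Y whose local ring contains a
   given finite subset of K form a basis of the topology. *)
Definition restriction_section D E (s : set K -> K) : Prop :=
  forall P, Y P -> P `<=` E ->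
    exists (U : seq K) (h : K), [set` U] `<=` P /\
      forall Q, Y Q -> Q `<=` E -> [set` U] `<=` Q ->
        O_stalk Y (\- D) Q h /\ restriction_kernel D E Q (s Q - h).

Definition nonzero_section D E (s : set K -> K) : Prop :=
  exists P, [/\ Y P, P `<=` E & ~ restriction_kernel D E P (s P)].

Definition antieffective D : Prop :=
  divisor Y D /\
  forall E, exceptional R Y E ->
    exists2 s, restriction_section D E s & nonzero_section D E s.

Definition antieffective_closure D Dt : Prop :=
  [/\ antieffective Dt, le_divisor D Dt
    & forall D', antieffective D' -> le_divisor D D' -> le_divisor Dt D'].

End Antieffective.

Section MultiplierIdeals.
Variables (K : fieldType) (R a : set K) (Y : set (set K)).
Variables (F Kpi : set K -> int).

Definition log_resolution : Prop :=
  [/\ proper_birational_model R Y,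
      forall P, Y P -> regular_local_ring P,
      divisor Y F /\ effective F,
      forall P, Y P -> span P a = O_stalk Y (\- F) P
    & snc_divisor Y (F \+ Exc R Y)].

Definition floor_divisor (c : rat) (E : set K) : int :=
  Num.floor (c * (F E)%:~R).

Definition multiplier_ideal (c : rat) : set K :=
  global_sections Y (Kpi \- floor_divisor c).

Definition jumping_sequence (lam : nat -> rat) : Prop :=
  [/\ lam 0%N = 0,
      forall i, lam i < lam i.+1,
      forall i c, lam i <= c < lam i.+1 ->
        multiplier_ideal c = multiplier_ideal (lam i)
    & forall i, multiplier_ideal (lam i.+1) `<` multiplier_ideal (lam i)].

Definition jumping_number (c : rat) : Prop :=
  exists lam, jumping_sequence lam /\ exists2 i, (0 < i)%N & c = lam i.

Definition is_min (T : set rat) (m : rat) : Prop := T m /\ lbound T m.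

(* The values (k_i + 1 + G_i) / e_i, for E_i a component of F. *)
Definition candidates (G : set K -> int) : set rat :=
  [set (Kpi E + 1 + G E)%:~R / (F E)%:~R | E in [set E | F E != 0]].

Inductive supercandidate : rat -> Prop :=
| supercandidate_first m :
    is_min (candidates (fun=> 0)) m -> supercandidate m
| supercandidate_next lam Dlam m :
    supercandidate lam ->
    antieffective_closure R Y (floor_divisor lam \- Kpi) Dlam ->
    is_min (candidates Dlam) m -> supercandidate m.

End MultiplierIdeals.

(* Main.v *)
(* Write H(D) for the global sections of O_Y(-D), so that the multiplier ideal at
   c is H(floor(cF) - Kpi).  If O_Y(-D) has no nonzero section on an exceptional
   E, then H(D) = H(D + E), and every antieffective D' >= D satisfies
   D' >= D + E.  The multiples of F are antieffective, so adding such E's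
   terminates, at the antieffective closure D~, and H(D) = H(D~).  Hence, for D_s
   the closure at a supercandidate s and t the next supercandidate, the multiplier
   ideal does not change on [s, t[: there floor(cF) - Kpi <= D_s.  As some
   coefficient of floor(sF) increases strictly from s to t, finitely many steps
   reach any given jumping number. *)

Require Import Defs.
From HB Require Import structures.
From mathcomp Require Import all_boot all_order all_algebra.
From mathcomp Require Import mathcomp_extra boolp classical_sets functions.
From mathcomp Require Import cardinality.
From mathcomp Require Import zify ring.

Set Implicit Arguments.
Unset Strict Implicit.
Unset Printing Implicit Defensive.

Import Order.TTheory GRing.Theory Num.Theory.
Local Open Scope classical_set_scope.
Local Open Scope ring_scope.

Local Notation span := Defs.span.

(** * Subrings of a field, spans and units *)

Section Subrings.
Variable K : fieldType.
Implicit Types (A B G I M P V p : set K) (x y : K).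

Lemma subringP A : subring A <->
  [/\ A 1, forall x y, A x -> A y -> A (x - y)
    & forall x y, A x -> A y -> A (x * y)].
Proof.
split=> [[A1 AB AM] | [A1 AB AM]].
  split=> [|x y Ax Ay|x y Ax Ay]; first by move: A1; rewrite inE.
    by have := AB x y; rewrite !inE; apply.
  by have := AM x y; rewrite !inE; apply.
split=> [|x y|x y]; rewrite !inE //; first exact: AB.
exact: AM.
Qed.

Lemma subring1 A : subring A -> A 1.
Proof. by move=> /subringP[]. Qed.

Lemma subringB A x y : subring A -> A x -> A y -> A (x - y).
Proof. by move=> /subringP[_ + _]; apply. Qed.

Lemma subringM A x y : subring A -> A x -> A y -> A (x * y).
Proof. by move=> /subringP[_ _]; apply. Qed.

Lemma subring0 A : subring A -> A 0.
Proof. by move=> sA; rewrite -(subrr 1); apply: subringB; try exact: subring1. Qed.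

Lemma subringD A x y : subring A -> A x -> A y -> A (x + y).
Proof.
move=> sA Ax Ay; rewrite -[y]opprK -[- y]add0r.
by do 2! [apply: subringB => //]; exact: subring0.
Qed.

Lemma subringX A x n : subring A -> A x -> A (x ^+ n).
Proof.
move=> sA Ax; elim: n => [|n IHn]; first by rewrite expr0; exact: subring1.
by rewrite exprS; exact: subringM.
Qed.

Lemma subring_smallest G : subring (smallest (@subring K) G).
Proof.
apply/subringP; split=> [|x y Gx Gy|x y Gx Gy] B GB; have [sB _] := GB.
- exact: subring1.
- by apply: subringB => //; [exact: (Gx B GB) | exact: (Gy B GB)].
- by apply: subringM => //; [exact: (Gx B GB) | exact: (Gy B GB)].
Qed.

Lemma submodule_span A G : submodule A (span A G).
Proof.
split=> [|x y Gx Gy|a x Aa Gx] M GM; have [[M0 MD MM] _] := GM => //.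
- by apply: MD; [exact: (Gx M GM) | exact: (Gy M GM)].
- by apply: MM => //; exact: (Gx M GM).
Qed.

Lemma span_mono A B G H : A `<=` B -> G `<=` H -> span A G `<=` span B H.
Proof.
move=> AB GH; have [M0 MD MM] := submodule_span B H.
apply: smallest_sub; last by move=> x /GH; exact: sub_gen_smallest.
by split=> // a x /AB; exact: MM.
Qed.

Lemma span_set1 A x : subring A -> span A [set x] = [set a * x | a in A].
Proof.
move=> sA; apply/seteqP; split.
  apply: smallest_sub => [|_ ->]; last by exists 1; rewrite ?mul1r //; exact: subring1.
  split=> [|_ _ [a Aa <-] [b Ab <-]|a _ Aa [b Ab <-]].
  - by exists 0; rewrite ?mul0r //; exact: subring0.
  - by exists (a + b); rewrite ?mulrDl //; exact: subringD.
  - by exists (a * b); rewrite ?mulrA //; exact: subringM.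
move=> _ [a Aa <-]; have [_ _] := submodule_span A [set x]; apply=> //.
exact: sub_gen_smallest.
Qed.

Lemma set_seq1 (T : eqType) (x : T) : [set` [:: x]] = [set x].
Proof. by apply/seteqP; split=> y /=; rewrite inE => /eqP. Qed.

Lemma is_unitV A x : is_unit A x -> is_unit A x^-1.
Proof. by case=> Ax x0 Ax1; split; rewrite ?invr_neq0 ?invrK. Qed.

Lemma is_unitM A x y : subring A -> is_unit A x -> is_unit A y -> is_unit A (x * y).
Proof.
move=> sA [Ax x0 Ax1] [Ay y0 Ay1]; split; rewrite ?mulf_neq0 ?invfM //;
  exact: subringM.
Qed.

Lemma is_unit1 A : subring A -> is_unit A 1.
Proof. by move=> sA; split; rewrite ?oner_neq0 ?invr1 //; exact: subring1. Qed.

Lemma is_unitXz A x (m : int) : subring A -> is_unit A x -> is_unit A (x ^ m).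
Proof.
move=> sA Ux.
have UX n : is_unit A (x ^+ n).
  by elim: n => [|n IHn]; rewrite ?expr0 ?exprS; [exact: is_unit1 | exact: is_unitM].
by case: m => n; [exact: UX | rewrite NegzE -exprnN; exact/is_unitV/UX].
Qed.

End Subrings.

(** * Discrete valuation rings and their order functions *)

Section DiscreteValuationRings.
Variable K : fieldType.
Implicit Types (E : set K) (t u x y : K) (m n : int).

(** The last clause makes K the fraction field and forces rank one: a principal maximal ideal alone
    would also allow valuation rings of higher rank. As t is a nonzero nonunit, E = K is
    excluded. *)
Definition uniformizer E t : Prop :=
  [/\ subring E, t != 0, nonunits E = span E [set t]
    & forall x, x != 0 -> exists u m, is_unit E u /\ x = u * t ^ m].

Definition dvr E : Prop := exists t, uniformizer E t.

Lemma nonunits_uniformizer E t : uniformizer E t -> nonunits E t.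
Proof. by move=> [sE _ -> _]; exact: sub_gen_smallest. Qed.

Lemma uniformizer_ge0 E t u m :
  uniformizer E t -> is_unit E u -> E (u * t ^ m) <-> 0 <= m.
Proof.
move=> ut [Eu u0 Eu1]; have [sE t0 tE _] := ut.
have [Et tN] := nonunits_uniformizer ut.
split=> [Eut|]; last by case: m => // n _; apply: subringM => //; exact: subringX.
case: m Eut => // n; rewrite NegzE => Eut; case: tN; split=> //.
have -> : t^-1 = u^-1 * t ^+ n * (u * t ^ (- (n.+1%:Z))).
  by rewrite -exprnN exprS; field; rewrite t0 u0 expf_neq0.
by do ! [apply: subringM => //]; exact: subringX.
Qed.

Lemma uniformizer_uniq E t u v m n : uniformizer E t ->
  is_unit E u -> is_unit E v -> u * t ^ m = v * t ^ n -> m = n.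
Proof.
move=> ut; have [_ t0 _ _] := ut.
have le a b i j : is_unit E a -> is_unit E b -> a * t ^ i = b * t ^ j -> i <= j.
  move=> [Ea a0 Ea1] Ub eab; rewrite -subr_ge0.
  rewrite -(uniformizer_ge0 _ ut Ub) expfzDr // mulrA -eab -mulrA -expfzDr //.
  by rewrite subrr mulr1.
by move=> Uu Uv euv; apply: le_anti; rewrite (le _ _ _ _ Uu Uv) // (le _ _ _ _ Uv Uu).
Qed.

(** [ord] chooses an exponent with respect to an arbitrary generator s of the maximal ideal. Since s
    and t are multiples of each other, with factors of product 1, they differ by a unit, and the
    exponent is independent of the choice. *)
Lemma ord_uniformizer E t u m :
  uniformizer E t -> is_unit E u -> ord E (u * t ^ m) = m.
Proof.
move=> ut Uu; have [sE t0 tE _] := ut.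
apply: xget_unique; first by exists t, u.
move=> n [s [v [sgen Uv eq]]].
have : nonunits E s by rewrite sgen; exact: sub_gen_smallest.
have : nonunits E t by exact: nonunits_uniformizer.
rewrite [in X in X -> _]sgen tE !span_set1 // => -[a Ea at_] [b Eb bt].
have ab1 : b * a = 1 by apply: (mulIf t0); rewrite -{2}at_ -bt; ring.
have b0 : b != 0 by apply: contra_eq_neq ab1 => ->; rewrite mul0r eq_sym oner_neq0.
have Ub : is_unit E b by split=> //; rewrite -(mul1r b^-1) -ab1 mulrAC mulfV // mul1r.
apply/esym/(uniformizer_uniq ut Uu (is_unitM sE Uv (is_unitXz n sE Ub))).
by rewrite eq -bt exprzMl ?unitfE // mulrA.
Qed.

Lemma ord_expansion E t x : uniformizer E t -> x != 0 ->
  exists2 u, is_unit E u & x = u * t ^ ord E x.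
Proof.
move=> ut x0; have [_ _ _ /(_ x x0)[u [m [Uu ->]]]] := ut.
by exists u; rewrite ?(ord_uniformizer _ ut).
Qed.

Lemma dvr_subring E : dvr E -> subring E.
Proof. by case=> t []. Qed.

Lemma dvr_ord1 E : dvr E -> exists x, [/\ E x, x != 0 & ord E x = 1].
Proof.
case=> t ut; have [Et _] := nonunits_uniformizer ut; exists t.
have [sE t0 _ _] := ut; split=> //.
by rewrite -[t]mul1r -[t]expr1z (ord_uniformizer _ ut) //; exact: is_unit1.
Qed.

Lemma ordM E x y : dvr E -> x != 0 -> y != 0 -> ord E (x * y) = ord E x + ord E y.
Proof.
move=> [t ut] x0 y0; have [sE t0 _ _] := ut.
have [u Uu {1}->] := ord_expansion ut x0; have [v Uv {1}->] := ord_expansion ut y0.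
by rewrite mulrACA -expfzDr // (ord_uniformizer _ ut) //; exact: is_unitM.
Qed.

Lemma ord1 E : dvr E -> ord E 1 = 0.
Proof.
by move=> vE; apply: (addIr (ord E 1)); rewrite add0r -ordM ?oner_neq0 // mulr1.
Qed.

Lemma ordX E x k : dvr E -> x != 0 -> ord E (x ^+ k) = k%:Z * ord E x.
Proof.
move=> vE x0; elim: k => [|k IHk]; first by rewrite expr0 ord1 // mul0r.
by rewrite exprS ordM ?expf_neq0 // IHk; lia.
Qed.

Lemma ordV E x : dvr E -> x != 0 -> ord E x^-1 = - ord E x.
Proof.
move=> vE x0; have := ordM vE x0 (invr_neq0 x0).
by rewrite mulfV // ord1 //; lia.
Qed.

Lemma ord_ge0 E x : dvr E -> x != 0 -> E x <-> 0 <= ord E x.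
Proof.
move=> [t ut] x0; have [u Uu {1}->] := ord_expansion ut x0.
exact: uniformizer_ge0.
Qed.

Lemma ord_gt0 E x : dvr E -> x != 0 -> nonunits E x <-> 1 <= ord E x.
Proof.
move=> vE x0; split=> [[Ex xN]|x1].
  case: (leP 1 (ord E x)) => // x1; case: xN; split=> //.
  by apply/(ord_ge0 vE); rewrite ?invr_neq0 // ordV //; lia.
split=> [|[_ _]]; first by apply/(ord_ge0 vE) => //; lia.
by move/(ord_ge0 vE); rewrite ?invr_neq0 // ordV // => /(_ isT); lia.
Qed.

(** Multiplication by t^(-m) carries this set onto E, so the ultrametric inequality follows from the
    closure of E under addition. *)
Lemma submodule_ord_ge E m : dvr E -> submodule E [set x | x = 0 \/ m <= ord E x].
Proof.
move=> vE; have sE := dvr_subring vE; have [t ut] := vE; have [_ t0 _ _] := ut.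
have ordt n : ord E (t ^ n) = n.
  by rewrite -[_ ^ n]mul1r (ord_uniformizer _ ut) //; exact: is_unit1.
have memP x : (x = 0 \/ m <= ord E x) <-> E (x * t ^ (- m)).
  have [->|x0] := eqVneq x 0.
    by rewrite mul0r; split=> _; [exact: subring0 | left].
  have xt0 : x * t ^ (- m) != 0 by rewrite mulf_neq0 ?expfz_neq0.
  apply: iff_trans (iff_sym (ord_ge0 vE xt0)); rewrite ordM ?expfz_neq0 // ordt.
  by split=> [[/eqP|]|]; rewrite ?(negPf x0) //; [|right]; lia.
split=> [|x y /memP Ex /memP Ey|b x Eb /memP Ex]; first by left.
  by apply/memP; rewrite mulrDl; exact: subringD.
by apply/memP; rewrite -mulrA; exact: subringM.
Qed.

Lemma dvr_valuation_ring E : dvr E -> valuation_ring E.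
Proof.
move=> vE; split=> [|x]; first exact: dvr_subring.
have [->|x0] := eqVneq x 0; first by left; exact: subring0 (dvr_subring vE).
case: (leP 0 (ord E x)) => ox; [left|right]; apply/(ord_ge0 vE); rewrite ?invr_neq0 //.
by rewrite ordV //; lia.
Qed.

Lemma dvr_eq E E' : dvr E -> dvr E' -> E `<=` E' -> E = E'.
Proof.
move=> vE vE' EE'; apply/seteqP; split=> // x E'x; apply: contrapT => Ex.
have x0 : x != 0 by apply: contra_notN Ex => /eqP ->; exact: subring0 (dvr_subring vE).
have ox : ord E x < 0.
  by case: (leP 0 (ord E x)) => // /(ord_ge0 vE x0).
have [t [E't t0 ot]] := dvr_ord1 vE'.
have s0 : t^-1 != 0 by rewrite invr_neq0.
(* every element of K is a power of x times an element of E, so E' = K *)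
have : E' t^-1.
  rewrite -[t^-1](mulfVK (expf_neq0 `|ord E t^-1|%N x0)); apply: subringM.
  - exact: dvr_subring.
  - apply/EE'/(ord_ge0 vE); rewrite ?mulf_neq0 ?invr_neq0 ?expf_neq0 //.
    rewrite ordM ?invr_neq0 ?expf_neq0 // [X in _ + X]ordV ?expf_neq0 // ordX //; nia.
  - by apply: subringX => //; exact: dvr_subring.
by move/(ord_ge0 vE' s0); rewrite ordV // ot.
Qed.

End DiscreteValuationRings.

(** * Localizations and regular local rings of dimension one *)

Section Localizations.
Variable K : fieldType.
Implicit Types (A B E P p : set K) (x y : K).

Lemma krull_dim_inj A m n : krull_dim A m -> krull_dim A n -> m = n.
Proof.
have le i j : krull_dim A i -> krull_dim A j -> (i <= j)%N.
  move=> [[c [pc lc]] _] [_ nc]; rewrite leqNgt; apply/negP => ji.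
  by apply: (nc c); split=> l lj; [apply: pc | apply: lc]; exact: leq_trans ji.
by move=> dm dn; apply/eqP; rewrite eqn_leq !le.
Qed.

Lemma prime_ideal_nonunits P : local_ring P -> prime_ideal P (nonunits P).
Proof.
move=> [sP iP]; split=> //; first by case=> _; apply; exact: is_unit1.
move=> x y Px Py [_ xyN]; have [ux|nx] := pselect (is_unit P x); last by left.
by right; split=> // uy; apply: xyN; exact: is_unitM.
Qed.

Lemma prime_ideal_setI A B p :
  subring A -> A `<=` B -> prime_ideal B p -> prime_ideal A (p `&` A).
Proof.
move=> sA AB [[[p0 pD pM] pB] p1 pP]; split; last 2 first.
- by case.
- by move=> x y Ax Ay [/(pP _ _ (AB _ Ax) (AB _ Ay))[]]; [left | right].
split; last by move=> x [].
split; first by split=> //; exact: subring0.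
  by move=> x y [px Ax] [py Ay]; split; [exact: pD | exact: subringD].
by move=> a x Aa [px Ax]; split; [apply: pM => //; exact: AB | exact: subringM].
Qed.

Lemma sub_localization A p : subring A -> prime_ideal A p -> A `<=` localization A p.
Proof.
by move=> sA [_ p1 _] x Ax; exists x, 1; rewrite divr1; split=> //; exact: subring1.
Qed.

Lemma localization_local A p : subring A -> prime_ideal A p ->
  forall s, A s -> ~ p s -> localization A p s^-1.
Proof.
by move=> sA pp s As ps; exists 1, s; rewrite div1r; split=> //; exact: subring1.
Qed.

Lemma localization_nonunits P :
  subring P -> local_ring P -> localization P (nonunits P) = P.
Proof.
move=> sP lP; apply/seteqP; split; last exact/sub_localization/prime_ideal_nonunits.
move=> _ [a [s [Pa Ps sN ->]]]; apply: subringM => //.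
by have [[]//|] := pselect (is_unit P s) => su; case: sN.
Qed.

Lemma localization_trans A p q : subring A -> prime_ideal A q ->
  let B := localization A q in subring B -> prime_ideal B p ->
  localization B p = localization A (p `&` A).
Proof.
move=> sA pq B sB pp; have AB : A `<=` B by exact: sub_localization.
have [[[_ _ pM] _] p1 pP] := pp; have [[[q0 _ _] _] _ _] := pq.
(* Elements of A outside q become units of B, so they avoid every prime of B. *)
have unitB s : A s -> ~ q s -> ~ p s.
  move=> As qs ps; apply: p1.
  have s0 : s != 0 by apply: contra_notN qs => /eqP->.
  by rewrite -(mulVf s0); apply: pM => //; exact: localization_local.
apply/seteqP; split.
  move=> _ [_ [_ [[a1 [s1 [Aa1 As1 qs1 ->]]] [a2 [s2 [Aa2 As2 qs2 ->]]] ps ->]]].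
  exists (a1 * s2), (s1 * a2); split; [exact: subringM | exact: subringM | | ].
  - case=> + _ => /(pP _ _ (AB _ As1) (AB _ Aa2))[]; first exact: unitB.
    by move=> pa2; apply: ps; rewrite mulrC; apply: pM => //; exact: localization_local.
  - by rewrite !invfM invrK; ring.
move=> _ [a [s [Aa As ps ->]]]; exists a, s; split=> //; try exact: AB.
by move=> ps'; apply: ps.
Qed.

(** Otherwise the ideals generated by the x / t^n form an ascending chain in E. Finite generation of
    their union gives x / t^(n+1) = b * x / t^n with b in E, so b = t^-1 and t would be a unit. *)
Lemma noetherian_not_infinitely_divisible E t x : subring E -> noetherian E ->
  nonunits E t -> t != 0 -> x != 0 -> exists n, ~ E (x / t ^+ n).
Proof.
move=> sE nE [Et tN] t0 x0; apply: contrapT => /forallNP Ex.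
pose J n := span E [set x / t ^+ n].
have J_le m n : (m <= n)%N -> J m `<=` J n.
  move=> mn; apply: smallest_sub; first exact: submodule_span.
  move=> _ ->; rewrite /J span_set1 //; exists (t ^+ (n - m)); first exact: subringX.
  by rewrite -{2}(subnK mn) exprD; field; rewrite !expf_neq0.
have idealJ : ideal E (\bigcup_n J n).
  split; last first.
    move=> y [n _]; rewrite /J span_set1 // => -[b Eb <-]; apply: subringM => //.
    exact: contrapT (Ex n).
  split=> [|y z [m _ my] [n _ nz]|b y Eb [n _ ny]].
  - by exists 0 => //; have [] := submodule_span E [set x / t ^+ 0].
  - exists (maxn m n) => //; have [_ + _] := submodule_span E [set x / t ^+ maxn m n].
    apply; [apply: J_le my; exact: leq_maxl | apply: J_le nz; exact: leq_maxr].
  - by exists n => //; have [_ _] := submodule_span E [set x / t ^+ n]; apply.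
have [s sI] := nE _ idealJ.
have [n sn] : exists n, [set` s] `<=` J n.
  have : [set` s] `<=` \bigcup_n J n by rewrite sI; exact: sub_gen_smallest.
  elim: s {sI} => [|y s IHs] sJ; first by exists 0.
  have [|n nJ] := IHs; first by move=> z zs; apply: sJ; rewrite /= inE zs orbT.
  have [|m _ mJ] := sJ y; first by rewrite /= inE eqxx.
  exists (maxn m n) => z /=; rewrite inE => /orP[/eqP->|/nJ].
    by apply: J_le mJ; rewrite leq_maxl.
  by apply: J_le; rewrite leq_maxr.
have : J n (x / t ^+ n.+1).
  suff : \bigcup_n J n `<=` J n by apply; exists n.+1 => //; exact: sub_gen_smallest.
  by rewrite sI; apply: smallest_sub => //; exact: submodule_span.
rewrite /J span_set1 // => -[b Eb bE]; apply: tN; split=> //; suff -> : t^-1 = b by [].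
have xt0 : x / t ^+ n != 0 by rewrite mulf_neq0 ?invr_neq0 ?expf_neq0.
by apply: (mulIf xt0); rewrite bE exprS; field; rewrite t0 expf_neq0.
Qed.

(** A regular system of parameters has a single member t, which generates the maximal ideal;
    dividing a nonzero element of E by t as often as possible leaves a unit. *)
Lemma regular_dim1_dvr E : regular_local_ring E -> krull_dim E 1 ->
  (forall x, exists a b, [/\ E a, E b & x = a / b]) -> dvr E.
Proof.
move=> [lE nE [s [ds sN]]] d1 fracE; have [sE iE] := lE.
move: (krull_dim_inj ds d1) sN => {ds}; case: s => [|t []] // _.
rewrite set_seq1 => tN; exists t.
have Nt : nonunits E t by rewrite tN; exact: sub_gen_smallest.
(* If t = 0, the maximal ideal is zero; it contains the larger prime of a chain of length one, which
   then cannot strictly contain the smaller. *)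
have t0 : t != 0.
  apply/eqP => t0; have [[c [pc lc]] _] := d1.
  have [_ []] := lc 0%N isT; have [[_ c1E] c11 _] := pc 1%N isT; move=> x c1x.
  have : nonunits E x.
    split; first exact: c1E.
    move=> [_ xn0 xV]; apply: c11; have [[[_ _ cM] _] _ _] := pc 1%N isT.
    by rewrite -(mulVf xn0); exact: cM.
  rewrite tN span_set1 // => -[b _ <-]; rewrite t0 mulr0.
  by have [[[]]] := pc 0%N isT.
split=> // x x0.
have key y : E y -> y != 0 -> exists u m, is_unit E u /\ y = u * t ^ m.
  move=> Ey y0; have := noetherian_not_infinitely_divisible sE nE Nt t0 y0.
  move=> exn; pose P n := ~~ `[< E (y / t ^+ n) >].
  have exP : exists n, P n by have [n yn] := exn; exists n; exact/asboolPn.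
  case: (ex_minnP exP) => -[|n] /asboolPn yn min.
    by case: yn; rewrite expr0 divr1.
  have Eyn : E (y / t ^+ n).
    by apply: contrapT => /asboolPn/min; rewrite ltnn.
  exists (y / t ^+ n), n%:Z; split; last by rewrite -exprnP divfK ?expf_neq0.
  apply: contrapT => nu; have : nonunits E (y / t ^+ n) by [].
  rewrite tN span_set1 // => -[b Eb bE]; apply: yn.
  by rewrite exprS invfM mulrCA -bE mulrC mulfK.
have [a [b [Ea Eb xab]]] := fracE x.
have a0 : a != 0 by apply: contra_neq x0 => a0; rewrite xab a0 mul0r.
have b0 : b != 0 by apply: contra_neq x0 => b0; rewrite xab b0 invr0 mulr0.
have [u [m [Uu au]]] := key _ Ea a0; have [v [n [Uv bv]]] := key _ Eb b0.
exists (u / v), (m - n); split; first exact/is_unitM/is_unitV.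
by rewrite xab au bv expfzDr // -invr_expz invfM mulrACA.
Qed.

End Localizations.

(** * Prime divisors on a proper regular model *)

Section ProperModels.
Variables (K : fieldType) (R : set K) (Y : set (set K)).
Hypothesis proper_Y : proper_birational_model R Y.
Hypothesis regular_Y : forall P, Y P -> regular_local_ring P.
Hypothesis frac_R : forall x, exists a b, [/\ R a, R b & x = a / b].
Implicit Types (A E P p : set K) (x y z f h : K) (D : set K -> int).

Lemma regular_subring P : regular_local_ring P -> subring P.
Proof. by case=> -[]. Qed.

Lemma model_chart P : Y P ->
  exists A, [/\ subring A, R `<=` A, Spec A P & Spec A `<=` Y].
Proof.
have [[cover ->] _] := proper_Y => -[s sc sP]; exists (adjoin R s); split=> //.
- exact: subring_smallest.
- by move=> x Rx; apply: sub_gen_smallest; left.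
- by move=> Q sQ; exists s.
Qed.

Lemma model_base_sub P : Y P -> R `<=` P.
Proof.
move=> /model_chart[A [sA RA [p pp ->] _]]; apply: (subset_trans RA).
exact: sub_localization.
Qed.

Lemma prime_divisor_dvr E : prime_divisor Y E -> dvr E.
Proof.
move=> [YE dE]; apply: regular_dim1_dvr => // [|x]; first exact: regular_Y.
have [a [b [Ra Rb ->]]] := frac_R x; exists a, b.
by split=> //; exact: (model_base_sub YE).
Qed.

Lemma prime_divisor_eq E E' :
  prime_divisor Y E -> prime_divisor Y E' -> E `<=` E' -> E = E'.
Proof. by move=> /prime_divisor_dvr vE /prime_divisor_dvr; exact: dvr_eq. Qed.

(* E and its localization at the centre of E on an affine chart through P are
   both dominated by the valuation ring E, so they coincide by properness. *)
Lemma prime_divisor_localization P E : Y P -> prime_divisor Y E -> P `<=` E ->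
  E = localization P (ideal_at E P).
Proof.
move=> YP dE PE; have vE := prime_divisor_dvr dE; have sE := dvr_subring vE.
have [YE _] := dE; have [lE _ _] := regular_Y YE.
have [A [sA RA [p pp defP] AY]] := model_chart YP.
have sP := regular_subring (regular_Y YP).
have AP : A `<=` P by rewrite defP; exact: sub_localization.
have pq := prime_ideal_setI sA (subset_trans AP PE) (prime_ideal_nonunits lE).
have pE := prime_ideal_setI sP PE (prime_ideal_nonunits lE).
have unitE s : E s -> ~ nonunits E s -> is_unit E s.
  by move=> Es nsE; apply: contrapT => us; exact: nsE.
set Q := localization A (nonunits E `&` A).
have QP : Q `<=` localization P (ideal_at E P).
  move=> _ [a [s [Aa As ns ->]]]; exists a, s; split=> //; try exact: AP.
  by move=> [Ns _]; apply: ns.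
have PE' : localization P (ideal_at E P) `<=` E.
  move=> _ [a [s [Pa Ps ns ->]]]; apply: subringM => //; first exact: PE.
  by have [] := unitE s (PE _ Ps) (fun Ns => ns (conj Ns Ps)).
have dEE : dominates E E by split.
have dEQ : dominates E Q.
  split=> [|_ [[a [s [Aa As ns ->]]] uas]]; first exact: subset_trans PE'.
  have Us := unitE s (PE _ (AP _ As)) (fun Ns => ns (conj Ns As)).
  have [Es s0 Es1] := Us; split; first by apply: subringM => //; exact/PE/AP.
  move=> [_ as0 as1]; apply: uas; split=> //.
    by exists a, s.
  have a0 : a != 0 by apply: contra_neq as0 => ->; rewrite mul0r.
  have Ua : is_unit E a.
    split=> //; first exact/PE/AP.
    have -> : a^-1 = (a / s)^-1 * s^-1 by rewrite invfM invrK mulfK.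
    exact: subringM.
  rewrite invfM invrK mulrC; exists s, a; split=> //.
  by move=> [[_ Na] _]; exact: Na.
have [_ /(_ E (dvr_valuation_ring vE) (model_base_sub YE))[P0 [_ uniq]]] := proper_Y.
have EQ : E = Q.
  rewrite -(uniq E) //; apply: uniq; split=> //; apply: AY.
  by exists (nonunits E `&` A).
by apply/seteqP; split=> //; rewrite {1}EQ.
Qed.

(** E is the localization of P at the prime (z), so a uniformizer of E is a / s with s a unit of E
    and a in (z), which forces order 1 for z. If z vanished along another E' through P, the ideal of
    E would lie in that of E'; then E' is contained in E, hence equal to it. *)
Lemma local_equation_ord P E z : Y P -> prime_divisor Y E -> P `<=` E ->
  ideal_at E P = span P [set z] ->
  [/\ z != 0, ord E z = 1
    & forall E', prime_divisor Y E' -> P `<=` E' -> E' <> E -> ord E' z = 0].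
Proof.
move=> YP dE PE zP; have vE := prime_divisor_dvr dE.
have sP := regular_subring (regular_Y YP); have sE := dvr_subring vE.
have [Nz Pz] : ideal_at E P z by rewrite zP; exact: sub_gen_smallest.
have [t [Et t0 ot]] := dvr_ord1 vE.
have [a [s [Pa Ps ns tas]]] : localization P (ideal_at E P) t.
  by rewrite -prime_divisor_localization.
have a0 : a != 0 by apply: contra_neq t0 => a0; rewrite tas a0 mul0r.
have s0 : s != 0 by apply: contra_neq t0 => s0; rewrite tas s0 invr0 mulr0.
have os : ord E s = 0.
  apply: le_anti; apply/andP; split; last by apply/(ord_ge0 vE s0)/PE.
  case: (leP (ord E s) 0) => // os; case: ns; split=> //.
  by apply/(ord_gt0 vE s0); lia.
have oa : ord E a = 1.
  by move: ot; rewrite tas ordM ?invr_neq0 // ordV // os oppr0 addr0.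
have : ideal_at E P a by split=> //; apply/(ord_gt0 vE a0); rewrite oa.
rewrite zP span_set1 // => -[b Pb ba].
have b0 : b != 0 by apply: contra_neq a0 => b0; rewrite -ba b0 mul0r.
have z0 : z != 0 by apply: contra_neq a0 => z0; rewrite -ba z0 mulr0.
split=> //.
  have oz : 1 <= ord E z by apply/(ord_gt0 vE z0).
  have ob : 0 <= ord E b by apply/(ord_ge0 vE b0)/PE.
  by move: oa; rewrite -ba ordM //; lia.
move=> E' dE' PE' E'E; have vE' := prime_divisor_dvr dE'.
have sE' := dvr_subring vE'.
apply: le_anti; apply/andP; split; last by apply/(ord_ge0 vE' z0)/PE'.
case: (leP (ord E' z) 0) => // oz; case: E'E; apply: prime_divisor_eq => // x.
have Nz' : nonunits E' z by apply/(ord_gt0 vE' z0); lia.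
rewrite [X in X x -> _](prime_divisor_localization YP dE' PE').
rewrite [X in _ -> X x](prime_divisor_localization YP dE PE).
move=> [c [r [Pc Pr nr ->]]]; exists c, r; split=> //; rewrite zP span_set1 //.
move=> [d Pd dr]; apply: nr; split=> //; rewrite -dr.
(* Zero is treated apart because [ord] is 0 there by convention. *)
have [E'0|dz0] := eqVneq (d * z) 0.
  rewrite E'0; split; first exact: subring0.
  by move=> [_]; rewrite eqxx.
have d0 : d != 0 by apply: contra_neq dz0 => ->; rewrite mul0r.
apply/(ord_gt0 vE' dz0); rewrite ordM //.
by have : 0 <= ord E' d; [apply/(ord_ge0 vE' d0)/PE' | lia].
Qed.

(** By properness E dominates a point P of Y. An element of R invertible in E cannot be a nonunit of
    P, so P contains the localization E of R. *)
Lemma base_dvr_model E : Spec R E -> subring R -> dvr E -> Y E.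
Proof.
move=> [p pp defE] sR vE; have sE := dvr_subring vE.
have RE : R `<=` E by rewrite defE; exact: sub_localization.
have [_ /(_ E (dvr_valuation_ring vE) RE)[P [[YP [PE NPE]] _]]] := proper_Y.
suff -> : E = P by [].
have sP := regular_subring (regular_Y YP); have RP := model_base_sub YP.
apply/seteqP; split=> //; rewrite {1}defE => _ [a [s [Ra Rs ns ->]]].
apply: subringM; [by []|exact: RP|].
have [[]//|us] := pselect (is_unit P s).
have [_ []] : nonunits E s by apply: NPE; split=> //; exact: RP.
split; [exact: RE | | by rewrite defE; exact: localization_local].
by apply: contra_notN ns => /eqP->; have [[[]]] := pp.
Qed.

Lemma O_stalk_prime_divisor D E f : prime_divisor Y E ->
  O_stalk Y D E f <-> f = 0 \/ 0 <= ord E f + D E.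
Proof.
move=> dE; split=> [[->|fE]|[->|fE]]; [by left|right; exact: fE|by left|right].
by move=> E' dE' EE'; rewrite -(prime_divisor_eq dE dE' EE').
Qed.

Lemma global_sectionsP D f : f != 0 ->
  global_sections Y D f <-> forall E, prime_divisor Y E -> 0 <= ord E f + D E.
Proof.
move=> f0; split=> [fD E dE|fD P _]; last by right=> E dE _; exact: fD.
have [YE _] := dE; have [/eqP|] := fD E YE; first by rewrite (negPf f0).
by apply.
Qed.

Lemma global_sections0 D : global_sections Y D 0.
Proof. by move=> P _; left. Qed.

End ProperModels.

(** * Restriction to exceptional divisors and the antieffective closure *)

Section AntieffectiveClosure.
Variables (K : fieldType) (R a : set K) (Y : set (set K)) (F : set K -> int).
Hypothesis logres : log_resolution R a Y F.
Hypothesis frac_R : forall x, exists a b, [/\ R a, R b & x = a / b].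
Implicit Types (A E P Q p : set K) (x y z f h : K) (D G : set K -> int).

Let proper_Y : proper_birational_model R Y. Proof. by case: logres. Qed.
Let regular_Y P : Y P -> regular_local_ring P.
Proof. by case: logres => _ + _ _ _; apply. Qed.
Let effective_F E : 0 <= F E. Proof. by case: logres => _ _ [_ +] _ _; apply. Qed.
Let dvr_Y E : prime_divisor Y E -> dvr E.
Proof. exact: (prime_divisor_dvr proper_Y regular_Y frac_R). Qed.

(** With the next lemma this compares I_E * O_Y(-D) with O_Y(-D - E): each generator is a product of
    an element of order at least 1 along E and one of order at least D E. *)
Lemma restriction_kernel_ord D E P h : prime_divisor Y E -> P `<=` E ->
  restriction_kernel Y D E P h -> h = 0 \/ D E + 1 <= ord E h.
Proof.
move=> dE PE; have vE := dvr_Y dE; have [S0 SD SM] := submodule_ord_ge (D E + 1) vE.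
pose S := [set x | x = 0 \/ D E + 1 <= ord E x].
suff : restriction_kernel Y D E P `<=` S by apply.
apply: smallest_sub; first by split=> // b x /PE; exact: SM.
move=> _ [x [Nx _] [y yD <-]]; rewrite /S /=.
have [->|xy0] := eqVneq (x * y) 0; [by left|right].
have x0 : x != 0 by apply: contra_neq xy0 => ->; rewrite mul0r.
have y0 : y != 0 by apply: contra_neq xy0 => ->; rewrite mulr0.
have /(ord_gt0 vE x0) ox := Nx.
case: yD => [/eqP|/(_ E dE PE)/=]; rewrite ?(negPf y0) // ordM //; lia.
Qed.

(** As F is effective, E lies in the support of F + Exc, so by simple normal crossings its ideal at
    P has a generator z. Dividing h by z lowers the order by one along E and leaves it unchanged
    along the other prime divisors through P. *)
Lemma ord_restriction_kernel D E P h : exceptional R Y E -> Y P -> P `<=` E ->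
  O_stalk Y (\- D) P h -> D E + 1 <= ord E h -> restriction_kernel Y D E P h.
Proof.
move=> [dE nE] YP PE hD oh; have [_ _ _ _ [_ snc]] := logres.
have [t _ /(_ E)[||z _ zP]] := snc P YP; rewrite //=.
  by rewrite /Exc asboolT //; have := effective_F E; lia.
have [z0 oz oz'] := local_equation_ord proper_Y regular_Y frac_R YP dE PE zP.
have [->|h0] := eqVneq h 0.
  by rewrite /restriction_kernel; have [] := submodule_span P
    [set x * y | x in ideal_at E P & y in O_stalk Y (\- D) P].
apply: sub_gen_smallest; exists z; first by rewrite zP; exact: sub_gen_smallest.
exists (h / z); last by rewrite mulrC divfK.
right=> E' dE' PE' /=; have vE' := dvr_Y dE'.
rewrite ordM ?invr_neq0 // ordV //.
have [->|E'E] := pselect (E' = E); first by rewrite oz; lia.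
by rewrite oz' //; case: hD => [/eqP|/(_ E' dE' PE')/=]; rewrite ?(negPf h0) //; lia.
Qed.

Lemma O_stalk_le D D' P : le_divisor D D' -> O_stalk Y (\- D') P `<=` O_stalk Y (\- D) P.
Proof.
move=> DD' f [->|fD']; [by left | right=> E dE PE].
by have := fD' E dE PE; have := DD' E => /=; lia.
Qed.

Lemma restriction_kernel_le D D' E P : le_divisor D D' ->
  restriction_kernel Y D' E P `<=` restriction_kernel Y D E P.
Proof.
move=> DD'; apply: span_mono => // _ [x Nx [y yD' <-]].
by exists x => //; exists y => //; exact: O_stalk_le DD' _ yD'.
Qed.

(* O_Y(-D')|_E -> O_Y(-D)|_E is injective when D' - D does not contain E. *)
Lemma restriction_section_le D D' E s : exceptional R Y E ->
  le_divisor D D' -> D' E = D E ->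
  restriction_section Y D' E s -> nonzero_section Y D' E s ->
  restriction_section Y D E s /\ nonzero_section Y D E s.
Proof.
move=> xE DD' eqE sD' [P [YP PE sP0]]; have [dE _] := xE; split.
  move=> Q YQ QE; have [U [h [UQ hU]]] := sD' Q YQ QE.
  exists U, h; split=> // Q' YQ' Q'E UQ'; have [hQ' sh] := hU Q' YQ' Q'E UQ'.
  by split; [exact: O_stalk_le hQ' | exact: restriction_kernel_le sh].
have [U [h [UP hU]]] := sD' P YP PE; have [YE _] := dE.
have [hP shP] := hU P YP PE UP.
have [_ shE] := hU E YE (@subset_refl _ E) (subset_trans UP PE).
(* Nonvanishing is tested at the generic point E, which lies in every neighbourhood of P in E.
   Vanishing there gives h order at least D E + 1 = D' E + 1, and h then lies in the kernel for D'
   at P as well. *)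
exists E; split=> // sE; apply: sP0.
have sub x y Q : restriction_kernel Y D' E Q x -> restriction_kernel Y D' E Q y ->
    restriction_kernel Y D' E Q (x + y).
  by have [_ + _] := submodule_span Q
    [set x * y | x in ideal_at E Q & y in O_stalk Y (\- D') Q]; apply.
rewrite -(subrK h (s P)); apply: sub => //.
have vE := dvr_Y dE; have [_ SD SM] := submodule_ord_ge (D' E + 1) vE.
have : h = 0 \/ D' E + 1 <= ord E h.
  have -> : h = s E + -1 * (s E - h) by ring.
  apply: SD; first by rewrite eqE; exact: restriction_kernel_ord sE.
  apply: SM; last exact: restriction_kernel_ord shE.
  by have := subringB (dvr_subring vE) (subring0 (dvr_subring vE))
    (subring1 (dvr_subring vE)); rewrite sub0r.
case=> [->|oh]; last exact: ord_restriction_kernel.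
by have [] := submodule_span P
  [set x * y | x in ideal_at E P & y in O_stalk Y (\- D') P].
Qed.

(** The constant family of germs f is a section of O_Y(-D)|_E; if it is not a nonzero section, f
    lies in the kernel at the generic point of E. *)
Lemma global_sections_restriction D E f : exceptional R Y E ->
  global_sections Y (\- D) f ->
  ~ (exists2 s, restriction_section Y D E s & nonzero_section Y D E s) ->
  f = 0 \/ D E + 1 <= ord E f.
Proof.
move=> [dE _] fD nos; apply: (@restriction_kernel_ord _ _ E) => //.
apply: contrapT => fN; apply: nos; exists (fun=> f); last first.
  by exists E; have [YE _] := dE; split.
move=> P YP PE; exists [::], f; split=> // Q YQ QE _; split; first exact: fD.
by rewrite subrr; have [] := submodule_span Q
  [set x * y | x in ideal_at E Q & y in O_stalk Y (\- D) Q].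
Qed.

(** The antieffective bound G ensures termination: each added E lowers the sum of G - D over the
    finite list [l] and stays below G. *)
Lemma antieffective_closure_exists D G :
  divisor Y D -> antieffective R Y G -> le_divisor D G ->
  exists2 Dt, antieffective_closure R Y D Dt
    & global_sections Y (\- D) `<=` global_sections Y (\- Dt).
Proof.
move=> dD aG DG.
have [l lP] : exists l : seq (set K), forall E, D E < G E -> E \in l.
  have [_ /finite_seqP[l1 l1D]] := dD; have [[_ /finite_seqP[l2 l2G]] _] := aG.
  exists (l1 ++ l2) => E DE; rewrite mem_cat.
  have [D0|D0] := eqVneq (D E) 0; last first.
    by have -> : E \in l1 by have : [set` l1] E by rewrite -l1D.
  have G0 : G E != 0 by apply/eqP; lia.
  have -> : E \in l2 by have : [set` l2] E by rewrite -l2G.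
  exact: orbT.
have [n] := ubnP (\sum_(E <- l) `|G E - D E|%N).
elim: n => // n IHn in D dD DG lP *; rewrite ltnS => sum_n.
have [aD|naD] := pselect (antieffective R Y D).
  by exists D => //; split=> // E.
have [E xE noE] : exists2 E, exceptional R Y E &
    ~ (exists2 s, restriction_section Y D E s & nonzero_section Y D E s).
  apply: contrapT => noE; apply: naD; split=> // E xE.
  by apply: contrapT => nos; apply: noE; exists E.
have [dE _] := xE.
pose D1 E' := D E' + (E' == E)%:R.
(* If D' E = D E, a nonzero section of O_Y(-D')|_E would map to one of O_Y(-D)|_E, against the
   choice of E. *)
have min1 D' : antieffective R Y D' -> le_divisor D D' -> le_divisor D1 D'.
  move=> [_ aD'] DD' E'; rewrite /D1; have := DD' E'.
  have [->|_] := eqVneq E' E; rewrite ?addr0 // => DE.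
  have : D E <> D' E; last by move=> ?; rewrite -[1%:R]/(1 : int); lia.
  move=> eqE; apply: noE; have [s sD' s0] := aD' E xE.
  by exists s; have [] := restriction_section_le xE DD' (esym eqE) sD' s0.
have DD1 : le_divisor D D1 by move=> E'; rewrite /D1 lerDl.
have D1G : le_divisor D1 G by exact: min1.
have D1E : D1 E = D E + 1 by rewrite /D1 eqxx.
have D1E' E' : E' != E -> D1 E' = D E' by rewrite /D1 => /negPf ->; rewrite addr0.
have [||//||Dt [aDt D1Dt minDt] secDt] := IHn D1.
- split=> [E'|].
    have [->//|/D1E' ->] := eqVneq E' E; by case: dD => + _; apply.
  apply: (@sub_finite_set _ _ ([set E] `|` [set E | D E != 0])).
    move=> E' /=; have [->|/D1E' ->] := eqVneq E' E; [by left|by right].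
  by rewrite finite_setU; split; [exact: finite_set1 | case: dD].
- by [].
- move=> E' lt; apply: lP; apply: le_lt_trans lt; exact: DD1.
- apply: leq_trans sum_n; have El : E \in l.
    by apply: lP; have := D1G E; rewrite D1E; lia.
  rewrite !(big_rem E El) /= -addSn leq_add //.
    by rewrite D1E; have := D1G E; rewrite D1E; lia.
  by apply: leq_sum => E' _; have := D1G E'; have := DD1 E'; lia.
exists Dt.
  split=> //; first by move=> E'; exact: le_trans (D1Dt E').
  by move=> D' aD' DD'; apply: minDt => //; exact: min1.
(* Sections of O_Y(-D) restrict to zero on E, so they are already sections of O_Y(-D1). *)
move=> f fD; apply: secDt => P YP.
have [->|f0] := eqVneq f 0; [by left | right=> E' dE' PE' /=].
have [->|/D1E' ->] := eqVneq E' E.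
  rewrite D1E; case: (global_sections_restriction xE fD noE) => [/eqP|]; last by lia.
  by rewrite (negPf f0).
by case: (fD P YP) => [/eqP|]; [rewrite (negPf f0) | apply].
Qed.

(** At the generic point of E, [a] spans O_Y(-F), which contains t^(F E) for a uniformizer t; so the
    nonzero elements of [a] cannot all have order above F E. *)
Lemma exists_ord_eq E : prime_divisor Y E -> exists g, [/\ a g, g != 0 & ord E g = F E].
Proof.
move=> dE; have vE := dvr_Y dE; have sE := dvr_subring vE; have [YE _] := dE.
have [_ _ _ /(_ E YE) aE _] := logres.
have stalkP := O_stalk_prime_divisor proper_Y regular_Y frac_R (\- F) _ dE.
apply: contrapT => no.
have sub : span E a `<=` [set x | x = 0 \/ F E + 1 <= ord E x].
  apply: smallest_sub => [|g ag /=]; first exact: submodule_ord_ge.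
  have [->|g0] := eqVneq g 0; [by left | right].
  have : O_stalk Y (\- F) E g by rewrite -aE; exact: sub_gen_smallest.
  move/stalkP => [/eqP|/=]; first by rewrite (negPf g0).
  by have ne : ord E g <> F E; [move=> og; apply: no; exists g | lia].
have [t [_ t0 ot]] := dvr_ord1 vE.
have F0 := effective_F E.
have oT : ord E (t ^+ `|F E|%N) = F E by rewrite ordX // ot; lia.
have : O_stalk Y (\- F) E (t ^+ `|F E|%N) by apply/stalkP; right; rewrite /= oT subrr.
rewrite -aE => /sub[/eqP|]; first by rewrite expf_eq0 (negPf t0) andbF.
by rewrite oT; lia.
Qed.

(** For g in [a] of order exactly F E along E, the power g^N is a global section of O_Y(-N F) that
    does not vanish at the generic point of E. These multiples serve as the bound G above. *)
Lemma antieffective_multiple (N : nat) : antieffective R Y (fun E => N%:Z * F E).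
Proof.
have [_ _ [[dF finF] _] aF _] := logres; split.
  split=> [E NF|]; first by apply: dF; apply: contra_neq NF => ->; rewrite mulr0.
  by apply: sub_finite_set finF => E /=; apply: contra_neq => ->; rewrite mulr0.
move=> E [dE _]; have [g [ag g0 og]] := exists_ord_eq dE.
have vE := dvr_Y dE; have [YE _] := dE.
have gN0 : g ^+ N != 0 by rewrite expf_neq0.
exists (fun=> g ^+ N); last first.
  exists E; split=> // /(restriction_kernel_ord dE (@subset_refl _ E))[/eqP|].
    by rewrite (negPf gN0).
  by rewrite ordX // og; lia.
move=> P YP PE; exists [::], (g ^+ N); split=> // Q YQ QE _; split; last first.
  by rewrite subrr; have [] := submodule_span Q
    [set x * y | x in ideal_at E Q & y in O_stalk Y (\- (fun E => N%:Z * F E)) Q].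
right=> E' dE' QE' /=; rewrite ordX //; last exact: dvr_Y.
have : O_stalk Y (\- F) Q g by rewrite -aF //; exact: sub_gen_smallest.
case=> [/eqP|/(_ E' dE' QE')/=]; rewrite ?(negPf g0) //; nia.
Qed.

End AntieffectiveClosure.

(** * Smooth germs and regularity of the sections of O_Y(Kpi) *)

Lemma smooth_germ_frac (k K : fieldType) (iota : {rmorphism k -> K}) (R : set K) :
  smooth_germ iota R -> forall x, exists a b, [/\ R a, R b & x = a / b].
Proof. by case=> s []. Qed.

Lemma smooth_germ_regular (k K : fieldType) (iota : {rmorphism k -> K}) (R : set K) :
  smooth_germ iota R -> forall E, Spec R E -> regular_local_ring E.
Proof.
move=> [s [regA AR _]] E [p pp defE]; have sR := regular_subring (regA _ AR).
have [q pq defR] := AR; apply: regA; exists (p `&` adjoin (range iota) s).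
  apply: prime_ideal_setI pp; first exact: subring_smallest.
  by rewrite defR; exact: sub_localization (subring_smallest _) pq.
rewrite defE {1}defR; apply: localization_trans; rewrite -?defR //.
exact: subring_smallest.
Qed.

Section RegularFunctions.
Variables (k K : fieldType) (iota : {rmorphism k -> K}).
Variables (R : set K) (Y : set (set K)) (Kpi : set K -> int).
Hypothesis germ_R : smooth_germ iota R.
Hypothesis proper_Y : proper_birational_model R Y.
Hypothesis regular_Y : forall P, Y P -> regular_local_ring P.
Hypothesis Kpi_rel : relative_canonical_divisor iota R Y Kpi.

Let frac_R := smooth_germ_frac germ_R.

Lemma smooth_germ_local : local_ring R.
Proof. by case: germ_R => s [regA AR _]; case: (regA _ AR). Qed.

Let dvr_Y E : prime_divisor Y E -> dvr E.
Proof. exact: (prime_divisor_dvr proper_Y regular_Y frac_R). Qed.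

Let sub_R := proj1 smooth_germ_local.

Lemma base_prime_divisor E : prime_divisor (Spec R) E -> prime_divisor Y E.
Proof.
move=> [RE dE]; split=> //.
have RsubE : R `<=` E by have [p pp ->] := RE; exact: sub_localization.
apply: (base_dvr_model proper_Y regular_Y RE sub_R).
apply: regular_dim1_dvr => // [|x]; first exact: (smooth_germ_regular germ_R RE).
have [a [b [Ra Rb ->]]] := frac_R x; exists a, b.
by split=> //; exact: RsubE.
Qed.

Lemma base_ord_ge0 E x : prime_divisor Y E -> R x -> x != 0 -> 0 <= ord E x.
Proof.
move=> dE Rx x0; apply/(ord_ge0 (dvr_Y dE) x0); have [YE _] := dE.
exact: (model_base_sub proper_Y YE).
Qed.

(** A uniformizer at E0 is a quotient of elements of R. Its numerator vanishes along E0 and has no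
    poles on Y, so a product of powers of such numerators clears the poles one divisor at a time. *)
Lemma exists_base_denominator (D : set K -> int) : finite_set [set E | D E != 0] ->
  exists2 h, h != 0 &
    forall E, prime_divisor (Spec R) E -> 0 <= ord E h + D E.
Proof.
move=> /finite_seqP[l lD].
suff [h h0 hD] : exists2 h, h != 0 & forall E, prime_divisor Y E ->
    0 <= ord E h /\ (E \in l -> 0 <= ord E h + D E).
  exists h => // E /base_prime_divisor/hD[oh]; have [D0 _|D0] := eqVneq (D E) 0.
    by rewrite D0 addr0.
  by apply; have : [set` l] E by rewrite -lD.
elim: l {lD} => [|E0 l [h h0 hD]].
  exists 1; first exact: oner_neq0.
  by move=> E dE; rewrite ord1 //; exact: dvr_Y.
have [dE0|nE0] := pselect (prime_divisor Y E0); last first.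
  exists h => // E dE; have [oh lE] := hD E dE; split=> //.
  by rewrite inE => /orP[/eqP EE0|//]; case: nE0; rewrite -EE0.
have [t [_ t0 ot]] := dvr_ord1 (dvr_Y dE0).
have [a [b [Ra Rb tab]]] := frac_R t.
have a0 : a != 0 by apply: contra_neq t0 => a0; rewrite tab a0 mul0r.
have b0 : b != 0 by apply: contra_neq t0 => b0; rewrite tab b0 invr0 mulr0.
have oa : 1 <= ord E0 a.
  move: ot; rewrite tab ordM ?invr_neq0 ?ordV //; try exact: dvr_Y.
  by have := base_ord_ge0 dE0 Rb b0; lia.
exists (h * a ^+ `|D E0|%N); first by rewrite mulf_neq0 ?expf_neq0.
move=> E dE; have [oh lE] := hD E dE; have oaE := base_ord_ge0 dE Ra a0.
rewrite ordM ?expf_neq0 ?ordX //; try exact: dvr_Y.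
split; first by nia.
rewrite inE => /orP[/eqP EE0|/lE]; last by nia.
by rewrite EE0 in oh oaE *; nia.
Qed.

(* This avoids the normality of R: all powers of f are regular in codimension
   one on Spec R, so up to a common denominator they lie in the stalk of the
   canonical sheaf at R, hence in that at E, which bounds their poles along E;
   so f has no pole along E. *)
Lemma global_sections_Kpi_regular f : global_sections Y Kpi f ->
  forall E, prime_divisor Y E -> f != 0 -> 0 <= ord E f.
Proof.
move=> fK E dE f0; have [_ _ exK [n [d [KY [KX [_ [_ [_ cY] [[_ finX] cX] _ _]]]]]]] := Kpi_rel.
have [h h0 hX] := exists_base_denominator finX.
have Rf E' : prime_divisor (Spec R) E' -> 0 <= ord E' f.
  move=> dE'; have dE'Y := base_prime_divisor dE'; have [YE' _] := dE'Y.
  have K0 : Kpi E' = 0.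
    by apply/eqP/negP => /negP/exK[_]; apply; case: dE'.
  have [/eqP|/(_ E' dE'Y (@subset_refl _ E'))] := fK E' YE'; first by rewrite (negPf f0).
  by rewrite K0 addr0.
have SR : Spec R R.
  exists (nonunits R); first exact: prime_ideal_nonunits smooth_germ_local.
  by rewrite localization_nonunits //; exact: smooth_germ_local.
have [YE _] := dE; have vE := dvr_Y dE.
have bound m : 0 <= ord E h + m%:Z * ord E f + KY E.
  have : O_stalk (Spec R) KX R (h * f ^+ m).
    right=> E' dE' _; have vE' := dvr_Y (base_prime_divisor dE').
    rewrite ordM ?expf_neq0 // ordX //; have := hX E' dE'; have := Rf E' dE'; nia.
  rewrite -cX // => omega_hf; have : omega_stalk d E (h * f ^+ m).
    apply: span_mono omega_hf; first exact: (model_base_sub proper_Y YE).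
    move=> _ [x Rx <-]; exists x => // j; exact: (model_base_sub proper_Y YE).
  rewrite cY // => -[/eqP|/(_ E dE (@subset_refl _ E))].
    by rewrite mulf_eq0 expf_eq0 (negPf h0) (negPf f0) andbF.
  by rewrite ordM ?expf_neq0 // ordX.
have := bound `|ord E h + KY E|.+1; nia.
Qed.

End RegularFunctions.

(** * Round-downs, candidates and jumping numbers *)

Section Candidates.
Variables (K : fieldType) (Y : set (set K)) (F Kpi : set K -> int).
Hypothesis effective_F : effective F.
Implicit Types (D G : set K -> int) (E : set K) (c m : rat).

Lemma floor_divisor_le c c' : c <= c' -> le_divisor (floor_divisor F c) (floor_divisor F c').
Proof. by move=> cc' E; apply: le_floor; rewrite ler_wpM2r // ler0z. Qed.

Lemma global_sections_le D D' :
  le_divisor D D' -> global_sections Y D `<=` global_sections Y D'.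
Proof.
move=> DD' f fD P YP; case: (fD P YP) => [->|fP]; [by left | right=> E dE PE].
by have := fP E dE PE; have := DD' E; lia.
Qed.

Lemma multiplier_ideal_anti c c' :
  c <= c' -> multiplier_ideal Y F Kpi c' `<=` multiplier_ideal Y F Kpi c.
Proof.
move=> cc'; apply: global_sections_le => E /=.
by have := floor_divisor_le cc' E; lia.
Qed.

(** The ideal at lam is strictly smaller than the one at the preceding member of the sequence, and
    the ideal at c equals or contains the latter. *)
Lemma jumping_number_strict lam c : jumping_number Y F Kpi lam -> c < lam ->
  ~ multiplier_ideal Y F Kpi c `<=` multiplier_ideal Y F Kpi lam.
Proof.
move=> [l [[_ incr const strict] [[//|i] _ ->]]] cl sub.
have [_] := strict i; apply; apply: subset_trans sub.
case: (leP (l i) c) => lc; first by rewrite (const i c) // lc cl.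
exact/multiplier_ideal_anti/ltW.
Qed.

Lemma candidates_has_min G : finite_set [set E | F E != 0] ->
  (exists E, F E != 0) -> exists m, is_min (candidates F Kpi G) m.
Proof.
move=> finF [E0 FE0].
have /finite_seqP[s sC] : finite_set (candidates F Kpi G) by exact: finite_image.
have : exists x, x \in s.
  exists ((Kpi E0 + 1 + G E0)%:~R / (F E0)%:~R).
  have /= : [set` s] ((Kpi E0 + 1 + G E0)%:~R / (F E0)%:~R) by rewrite -sC; exists E0.
  by [].
rewrite sC => {sC}; case: s => [[//]|x s] _.
elim: s x => [|y s IHs] x.
  exists x; split; first by rewrite /= inE.
  by move=> z /=; rewrite inE => /eqP->.
have [m [/= ms mlb]] := IHs y.
case: (leP x m) => xm; [exists x | exists m]; (split=> [|z]; rewrite /= in_cons ?eqxx //).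
- by case/predU1P => [->//|zs]; apply: le_trans xm _; apply: mlb.
- by rewrite ms orbT.
- by case/predU1P => [->|zs]; [exact: ltW | exact: mlb].
Qed.

(** On a component of F, c * F E lies strictly below the integer Kpi E + 1 + G E, so its floor is at
    most one less. Elsewhere the floor is 0, which is what the first hypothesis covers. *)
Lemma floor_divisor_lt_min G c m : (forall E, F E = 0 -> - Kpi E <= G E) ->
  is_min (candidates F Kpi G) m -> c < m ->
  forall E, floor_divisor F c E <= Kpi E + G E.
Proof.
move=> KG [_ mlb] cm E; rewrite /floor_divisor.
have [FE|FE] := eqVneq (F E) 0.
  by rewrite FE mulr0 -[0]/(0%:~R) intrKfloor; have := KG E FE; lia.
have F0 : 0 < (F E)%:~R :> rat by rewrite ltr0z lt_neqAle eq_sym FE effective_F.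
suff : Num.floor (c * (F E)%:~R) < Kpi E + 1 + G E by lia.
by rewrite floor_lt_int -ltr_pdivlMr //; apply: lt_le_trans cm _; apply: mlb; exists E.
Qed.

(** Where the minimum is attained, m * F E is an integer, one above the bound valid for c < m; this
    is the source of strict progress. *)
Lemma floor_divisor_min G m : is_min (candidates F Kpi G) m ->
  exists2 E, F E != 0 & floor_divisor F m E = Kpi E + 1 + G E.
Proof.
move=> [[E FE <-] _]; exists E => //.
by rewrite /floor_divisor divfK ?intr_eq0 // intrKfloor.
Qed.

End Candidates.

(** * Climbing through the supercandidates to a jumping number *)

Theorem theorem4p4 (k : closedFieldType) (char_k : [pchar k] =i pred0)
    (K : fieldType) (iota : {rmorphism k -> K})
    (R : set K) (germ_R : smooth_germ iota R)
    (n : nat) (dim_R : krull_dim R n) (n_ge2 : (2 <= n)%N)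
    (a : set K) (ideal_a : ideal R a) (a_neq0 : a <> [set 0])
    (a_proper : a <> R)
    (Y : set (set K)) (F : set K -> int) (logres : log_resolution R a Y F)
    (Kpi : set K -> int) (Kpi_rel : relative_canonical_divisor iota R Y Kpi)
    (lam : rat) (lam_jump : jumping_number Y F Kpi lam) :
  supercandidate R Y F Kpi lam.
Proof.
have [proper_Y regular_Y [dF effF] _ _] := logres.
have [dK effK _ _] := Kpi_rel; have [_ finF] := dF.
have frac_R := smooth_germ_frac germ_R.
have strict := jumping_number_strict effF lam_jump.
(* For F = 0 the multiplier ideal would be independent of the exponent. *)
have suppF : exists E, F E != 0.
  apply: contrapT => /forallNP noF; apply: (strict (lam - 1)); first by rewrite ltrBlDr ltrDl.
  apply: global_sections_le => E /=; rewrite /floor_divisor.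
  by have /negP/negPn/eqP-> := noF E; rewrite !mulr0.
have [m m_min] := candidates_has_min Kpi (fun=> 0) finF suppF.
(* Below m the round-down of cF is at most Kpi, and the sections of O_Y(Kpi) have no poles; so the
   ideal at such a lam would contain the one at 0. *)
have m_le : m <= lam.
  rewrite leNgt; apply/negP => lam_m.
  have lam_gt0 : 0 < lam.
    have [l [[l0 incr _ _] [i i0 ->]]] := lam_jump.
    by have : {homo l : i j / (i < j)%N >-> i < j} by [exact: homo_ltn lt_trans incr];
      move=> /(_ 0%N i i0); rewrite l0.
  apply: (strict 0) => // f fK.
  have [->|f0] := eqVneq f 0; first exact: global_sections0.
  have fKpi : global_sections Y Kpi f.
    apply: global_sections_le fK => E /=.
    by rewrite /floor_divisor mul0r -[0]/(0%:~R) intrKfloor subr0.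
  have f_reg := global_sections_Kpi_regular germ_R proper_Y regular_Y Kpi_rel fKpi.
  apply/(global_sectionsP _ _ f0) => E dE /=.
  have effK' E' : F E' = 0 -> - Kpi E' <= 0 by rewrite oppr_le0.
  have := floor_divisor_lt_min effF effK' m_min lam_m E.
  by have := f_reg E dE f0; lia.
have [l lF] : exists l : seq (set K), [set E | F E != 0] = [set` l] by exact/finite_seqP.
(* The distance still to climb: round-downs increase with the exponent, so [mu] decreases as
   supercandidates approach lam from below. *)
pose mu c := (\sum_(E <- l) `|floor_divisor F lam E - floor_divisor F c E|)%N.
have climb N s : (mu s < N)%N -> supercandidate R Y F Kpi s -> s <= lam ->
    supercandidate R Y F Kpi lam.
  elim: N s => // N IHN s; rewrite ltnS => mu_s cand_s; rewrite le_eqVlt.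
  case/predU1P => [<-//|s_lam].
  pose D := floor_divisor F s \- Kpi.
  have floor_s0 E : F E = 0 -> floor_divisor F s E = 0.
    by rewrite /floor_divisor => ->; rewrite mulr0 -[0]/(0%:~R) intrKfloor.
  have dD : divisor Y D.
    have supp E : D E != 0 -> F E != 0 \/ Kpi E != 0.
      have [F0|] := eqVneq (F E) 0; last by left.
      by rewrite /D /= floor_s0 // sub0r oppr_eq0; right.
    have [dF1 _] := dF; have [dK1 finK] := dK; split=> [E /supp[/dF1|/dK1]//|].
    by apply: (@sub_finite_set _ _ ([set E | F E != 0] `|` [set E | Kpi E != 0]));
      [move=> E /supp | rewrite finite_setU].
  (* A multiple N F with N at least s bounds the round-down of sF, and subtracting the effective Kpi
     only helps. *)
  have DG : le_divisor D (fun E => (Num.bound `|s|)%:Z * F E).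
    move=> E; rewrite /D /=; have := effK E => /= K0.
    suff : floor_divisor F s E <= (Num.bound `|s|)%:Z * F E by lia.
    rewrite -[X in _ <= X](@intrKfloor rat) le_floor // intrM ler_wpM2r ?ler0z //.
    by apply: le_trans (ler_norm s) _; exact/ltW/archi_boundP.
  have [Dt closDt secDt] := antieffective_closure_exists logres frac_R dD
    (antieffective_multiple logres frac_R _) DG.
  have [t t_min] := candidates_has_min Kpi Dt finF suppF.
  have [_ DDt _] := closDt.
  have cand_t : supercandidate R Y F Kpi t by exact: supercandidate_next cand_s closDt t_min.
  have KDt E : F E = 0 -> - Kpi E <= Dt E.
    by move=> F0; have := DDt E; rewrite /D /= floor_s0 // sub0r.
  (* At this E the round-down for t is Kpi E + 1 + Dt E, and Dt E is at least the round-down for s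
     minus Kpi E: a strict increase. *)
  have [E FE floor_t] := floor_divisor_min t_min.
  have := DDt E; rewrite /D /= => DDtE.
  have floor_st : floor_divisor F s E < floor_divisor F t E by rewrite floor_t; lia.
  have st : s <= t.
    rewrite leNgt; apply/negP => /ltW /(floor_divisor_le effF)/(_ E); lia.
  (* If lam < t, the round-down of lam F minus Kpi is at most Dt, so the ideal at s, whose elements
     are sections of O_Y(-Dt), would lie in the one at lam. *)
  have t_lam : t <= lam.
    rewrite leNgt; apply/negP => lam_t; apply: (strict s) => // f fs.
    have /secDt : global_sections Y (\- D) f.
      by apply: global_sections_le fs => E' /=; rewrite /D /=; lia.
    apply: global_sections_le => E' /=.
    by have := floor_divisor_lt_min effF KDt t_min lam_t E'; lia.
  apply: (IHN t) => //; apply: leq_trans mu_s; have El : E \in l.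
    by have : [set` l] E by rewrite -lF.
  rewrite /mu !(big_rem E El) /= -addSn leq_add //.
    by have := floor_divisor_le effF t_lam E; lia.
  apply: leq_sum => E' _; have := floor_divisor_le effF t_lam E'.
  by have := floor_divisor_le effF st E'; lia.
exact: climb (ltnSn _) (supercandidate_first R Y m_min) m_le.
Qed.
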